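(* Let $l\ge4$, $m\ge4$, $a\ge0$ be integers. If $\binom{l+m-6}{l-3}-m+1\ge 0$, then $$f\!\left(l,m,\tbinom{l+m-6}{l-3}-m+1,\,a\right)>f(l,m),$$ and if $\binom{l+m-6}{m-3}-l+1\ge0$, then $$f\!\left(l,m,\,a,\tbinom{l+m-6}{m-3}-l+1\right)>f(l,m),$$ where $f(l,m)=\binom{l+m-4}{l-2}+1$. Here an inequality $F>f(l,m)$ means that there is a set $\mathcal X$ as below with at least $f(l,m)$ points that contains no $l$-cup with at most the stated number of points inside and no $m$-cap with at most the stated number of points inside (in particular it holds if $F$ does not exist).
   Context: Fix Cartesian coordinates $(x,y)$ in the plane. Let $\mathcal X$ be a finite set of points in general position (no three collinear) with pairwise distinct $x$-coordinates. A subset $\{(x_{1},y_{1}),\dots,(x_{r},y_{r})\}$ with $x_1<\dots<x_r$ is an $r$-cup if the slopes $\frac{y_{j+1}-y_j}{x_{j+1}-x_j}$, $j=1,\dots,r-1$, are strictly increasing in $j$, and an $r$-cap if they are strictly decreasing. The points of $\mathcal X$ inside a cup or cap are the points of $\mathcal X$ lying in the interior of the convex hull of the cup or cap. $f(l,m)$ is the least positive integer such that every such set with at least $f(l,m)$ points contains an $l$-cup or an $m$-cap; by Erdős–Szekeres, $f(l,m)=\binom{l+m-4}{l-2}+1$. $f(l,m,l_1,m_1)$ is the least positive integer (if it exists) such that every such set $\mathcal X$ with at least $f(l,m,l_1,m_1)$ points contains an $l$-cup with at most $l_1$ points of $\mathcal X$ inside or an $m$-cap with at most $m_1$ points of $\mathcal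 X$ inside. *)

(* Defs.v *)
From Stdlib Require Import Reals List Arith.
Import ListNotations.
Open Scope R_scope.

Definition pt : Type := (R * R)%type.

Fixpoint binom (n k : nat) : nat :=
  match n, k with
  | _, O => 1%nat
  | O, S _ => 0%nat
  | S n', S k' => (binom n' k' + binom n' (S k'))%nat
  end.

Definition fES (l m : nat) : nat := (binom (l + m - 4) (l - 2) + 1)%nat.

Definition cross (p q r : pt) : R :=
  (fst q - fst p) * (snd r - snd p) - (snd q - snd p) * (fst r - fst p).

Definition admissible (X : list pt) : Prop :=
  NoDup (map fst X) /\
  (forall p q r, In p X -> In q X -> In r X -> p <> q -> q <> r -> p <> r ->
     cross p q r <> 0).

Definition slope (p q : pt) : R := (snd q - snd p) / (fst q - fst p).

Definition pd : pt := (0, 0).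

Definition sub_increasing (X s : list pt) : Prop :=
  (forall p, In p s -> In p X) /\
  (forall j, (S j < length s)%nat -> fst (nth j s pd) < fst (nth (S j) s pd)).

Definition is_cup (X : list pt) (r : nat) (s : list pt) : Prop :=
  length s = r /\ sub_increasing X s /\
  (forall j, (S (S j) < length s)%nat ->
     slope (nth j s pd) (nth (S j) s pd) < slope (nth (S j) s pd) (nth (S (S j)) s pd)).

Definition is_cap (X : list pt) (r : nat) (s : list pt) : Prop :=
  length s = r /\ sub_increasing X s /\
  (forall j, (S (S j) < length s)%nat ->
     slope (nth j s pd) (nth (S j) s pd) > slope (nth (S j) s pd) (nth (S (S j)) s pd)).

Definition in_conv (s : list pt) (p : pt) : Prop :=
  exists w : list R,
    length w = length s /\ Forall (fun t => 0 <= t) w /\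
    fold_right Rplus 0 w = 1 /\
    fst p = fold_right Rplus 0 (map (fun c => fst c * fst (snd c)) (combine w s)) /\
    snd p = fold_right Rplus 0 (map (fun c => fst c * snd (snd c)) (combine w s)).

Definition in_interior_conv (s : list pt) (p : pt) : Prop :=
  exists eps, 0 < eps /\
    forall q : pt, (fst q - fst p)^2 + (snd q - snd p)^2 < eps^2 -> in_conv s q.

Definition at_most_inside (X s : list pt) (k : nat) : Prop :=
  exists Y : list pt, NoDup Y /\
    (forall p, In p Y <-> (In p X /\ in_interior_conv s p)) /\
    (length Y <= k)%nat.

Definition has_good_cup_or_cap (X : list pt) (l m l1 m1 : nat) : Prop :=
  (exists s, is_cup X l s /\ at_most_inside X s l1) \/
  (exists s, is_cap X m s /\ at_most_inside X s m1).

(* Main.v *)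
Require Import Defs.
From Stdlib Require Import Reals List Arith.
From Stdlib Require Import Lra Lia Sorting.Sorted.
Import ListNotations.

(** Write A/B for the Erdős–Szekeres join: B is far to the right and so high that two points
    of A and one of B form a cup, one of A and two of B a cap. Let X_{l,m} = X_{l-1,m} / X_{l,m-1}
    be the extremal sets with neither an l-cup nor an m-cap. In
    X_{l,m} = (X_{l-2,m} / X_{l-1,m-1}) / X_{l,m-1} take for the middle part the union of a set Y
    and a cap Z of m-2 points to its right, and insert one point p between Y and Z such that
    p together with Z is an (m-1)-cap. A point a of the left part sees [a, p, z] as a cup,
    so this cap does not extend to an m-cap. The only new l-cups consist of l-3 points of the left
    part, then p, a point of Z and a point b of the right part; if a is the last of those l-3
    points, the triangle (a, p, b) contains all of Y, which has binom(l+m-6, l-3) - (m-2) points.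
    The second half of the statement is the mirror image under y -> -y. *)

(** * Left-to-right order, turns and general position *)

Definition ltx (p q : pt) : Prop := fst p < fst q.

Definition left_of (A B : list pt) : Prop :=
  forall a b, In a A -> In b B -> ltx a b.

(** Orientations of consecutive triples stand in for comparisons of slopes: they involve no
    division, and an affine map multiplies all of them by one constant. The sign [e] lets one
    argument serve cups and caps. *)
Fixpoint turns (e : R) (s : list pt) : Prop :=
  match s with
  | p :: t => match t with q :: r :: _ => 0 < e * cross p q r | _ => True end /\ turns e t
  | [] => True
  end.

(* [e = 1] gives cups and [e = -1] gives caps. *)
Definition chain (e : R) (X s : list pt) : Prop :=
  incl s X /\ StronglySorted ltx s /\ turns e s.

Definition bounded (e : R) (X : list pt) (k : nat) : Prop :=
  forall s, chain e X s -> (length s <= k)%nat.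

(** Asking only for triples ordered from left to right fits the join arguments;
    [general_position_admissible] recovers arbitrary triples. *)
Definition general_position (X : list pt) : Prop :=
  NoDup (map fst X) /\
  forall p q r, In p X -> In q X -> In r X -> ltx p q -> ltx q r -> cross p q r <> 0.

(** * Chains *)

Lemma turns_app_l (e : R) (s1 s2 : list pt) : turns e (s1 ++ s2) -> turns e s1.
Proof.
  induction s1 as [|p [|q [|r s1]] IH]; simpl in *; try tauto.
Qed.

Lemma turns_app_r (e : R) (s1 s2 : list pt) : turns e (s1 ++ s2) -> turns e s2.
Proof.
  induction s1 as [|p s1 IH]; simpl; tauto.
Qed.

(** The witness is the last point of [s1]. This lemma and the next extract from a chain across two
    sets a mixed triple whose orientation can be contradicted. *)
Lemma turns_at_right (e : R) (s1 s : list pt) (b b' : pt) :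
  s1 <> [] -> turns e (s1 ++ b :: b' :: s) -> exists a, In a s1 /\ 0 < e * cross a b b'.
Proof.
  intros Hn H. destruct (exists_last Hn) as [s0 [a ->]].
  rewrite <- app_assoc in H. apply turns_app_r in H. simpl in H.
  exists a. split; [apply in_or_app; simpl; tauto | tauto].
Qed.

Lemma turns_at_left (e : R) (s1 s : list pt) (b : pt) :
  (2 <= length s1)%nat -> StronglySorted ltx s1 -> turns e (s1 ++ b :: s) ->
  exists a a', In a s1 /\ In a' s1 /\ ltx a a' /\ 0 < e * cross a a' b.
Proof.
  induction s1 as [|a [|a' s1] IH]; simpl; intros Hl Hs Ht; try lia.
  destruct s1 as [|a'' s1].
  - exists a, a'. simpl in *. inversion Hs as [|? ? _ Hf]; subst.
    inversion Hf; subst. tauto.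
  - inversion Hs; subst.
    destruct IH as (u & v & Hu & Hv & Huv); simpl in *; try lia; try tauto.
    exists u, v. tauto.
Qed.

Lemma StronglySorted_app (s1 s2 : list pt) :
  StronglySorted ltx (s1 ++ s2) -> StronglySorted ltx s1 /\ StronglySorted ltx s2.
Proof.
  induction s1 as [|p s1 IH]; simpl; intros H; [split; [constructor|exact H]|].
  inversion H as [|? ? H1 H2]; subst. destruct (IH H1) as [Ha Hb]. split; [|exact Hb].
  constructor; [exact Ha|]. rewrite Forall_app in H2. tauto.
Qed.

Lemma sorted_split (A B s : list pt) :
  left_of A B -> incl s (A ++ B) -> StronglySorted ltx s ->
  exists s1 s2, s = s1 ++ s2 /\ incl s1 A /\ incl s2 B.
Proof.
  intros HL. induction s as [|p s IH]; intros Hi Hs.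
  { exists [], []. repeat split; intros ? []. }
  inversion Hs as [|? ? H1 H2]; subst.
  destruct IH as (s1 & s2 & -> & HA & HB); auto.
  { intros q Hq. apply Hi. right. exact Hq. }
  destruct (in_app_or _ _ _ (Hi p (or_introl eq_refl))) as [Hp|Hp].
  - exists (p :: s1), s2. split; [reflexivity|split]; auto.
    intros q [<-|Hq]; auto.
  - destruct s1 as [|a s1].
    + exists [], (p :: s2). split; [reflexivity|split]; auto.
      intros q [<-|Hq]; auto.
    + exfalso. rewrite Forall_forall in H2.
      assert (h1 := H2 a (or_introl eq_refl)).
      assert (h2 := HL a p (HA a (or_introl eq_refl)) Hp).
      unfold ltx in *. lra.
Qed.

Lemma chain_split (e : R) (A B s : list pt) :
  left_of A B -> chain e (A ++ B) s ->
  exists s1 s2, s = s1 ++ s2 /\ chain e A s1 /\ chain e B s2.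
Proof.
  intros HL (Hi & Hs & Ht).
  destruct (sorted_split A B s HL Hi Hs) as (s1 & s2 & -> & HA & HB).
  exists s1, s2. split; [reflexivity|].
  apply StronglySorted_app in Hs.
  repeat split; try tauto; [eapply turns_app_l|eapply turns_app_r]; eassumption.
Qed.

(** Strictly increasing abscissae make [s] duplicate-free. *)
Lemma sorted_length_le (X s : list pt) :
  incl s X -> StronglySorted ltx s -> (length s <= length X)%nat.
Proof.
  intros Hi Hs. apply NoDup_incl_length; [|exact Hi]. clear Hi.
  induction Hs as [|p s Hs IH Hf]; constructor; auto.
  intros Hin. rewrite Forall_forall in Hf. specialize (Hf p Hin). unfold ltx in Hf. lra.
Qed.

Lemma chain_tail (e : R) (X s : list pt) (p : pt) : chain e X (p :: s) -> chain e X s.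
Proof.
  intros (Hi & Hs & Ht). inversion Hs; subst. simpl in Ht.
  repeat split; try tauto. intros q Hq. apply Hi. right. exact Hq.
Qed.

(** * Joining two sets along a steep direction *)

(* For [e = 1], [B] lies above every line spanned by [A] and [A] below every line
   spanned by [B]; for [e = -1] above and below are exchanged. *)
Definition joined (e : R) (A B : list pt) : Prop :=
  left_of A B /\
  (forall a a' b, In a A -> In a' A -> In b B -> ltx a a' -> 0 < e * cross a a' b) /\
  (forall a b b', In a A -> In b B -> In b' B -> ltx b b' -> e * cross a b b' < 0).

Lemma sorted_head (p q : pt) (s : list pt) : StronglySorted ltx (p :: q :: s) -> ltx p q.
Proof.
  intros H. inversion H as [|? ? _ Hf]; subst. inversion Hf; subst. assumption.
Qed.

(** Two points of [B] after a point of [A] would turn against [e]. Dually, in the next lemma, two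
    points of [A] before a point of [B] turn with [e]. *)
Lemma joined_chain_same (e : R) (A B s : list pt) :
  joined e A B -> chain e (A ++ B) s ->
  chain e B s \/ exists s1 s2, s = s1 ++ s2 /\ chain e A s1 /\ chain e B s2 /\ (length s2 <= 1)%nat.
Proof.
  intros (HL & _ & H) Hc.
  destruct (chain_split e A B s HL Hc) as (s1 & s2 & -> & HA & HB).
  destruct s1 as [|a s1]; [left; exact HB|right].
  exists (a :: s1), s2. repeat split; try apply HA; try apply HB.
  destruct s2 as [|b [|b' s2]]; simpl; try lia. exfalso.
  destruct Hc as (_ & _ & Ht). destruct HB as (HiB & HsB & _). destruct HA as (HiA & _ & _).
  destruct (turns_at_right e (a :: s1) s2 b b' ltac:(discriminate) Ht) as (c & Hc & Hx).
  assert (h := H c b b' (HiA c Hc) (HiB b ltac:(simpl; tauto)) (HiB b' ltac:(simpl; tauto))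
                 (sorted_head _ _ _ HsB)).
  lra.
Qed.

Lemma joined_chain_opp (e : R) (A B s : list pt) :
  joined e A B -> chain (- e) (A ++ B) s ->
  chain (- e) A s \/
  exists s1 s2, s = s1 ++ s2 /\ chain (- e) A s1 /\ chain (- e) B s2 /\ (length s1 <= 1)%nat.
Proof.
  intros (HL & H & _) Hc.
  destruct (chain_split (- e) A B s HL Hc) as (s1 & s2 & -> & HA & HB).
  destruct s2 as [|b s2]; [left; rewrite app_nil_r; exact HA|right].
  exists s1, (b :: s2). repeat split; try apply HA; try apply HB.
  destruct (le_lt_dec (length s1) 1) as [|Hl]; [assumption|exfalso].
  destruct Hc as (_ & _ & Ht). destruct HB as (HiB & _ & _). destruct HA as (HiA & HsA & _).
  destruct (turns_at_left (- e) s1 s2 b Hl HsA Ht) as (a & a' & Ha & Ha' & Haa & Hx).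
  assert (h := H a a' b (HiA _ Ha) (HiA _ Ha') (HiB b ltac:(simpl; tauto)) Haa).
  lra.
Qed.

Lemma joined_bounded_same (e : R) (A B : list pt) (k : nat) :
  joined e A B -> bounded e A k -> bounded e B (S k) -> bounded e (A ++ B) (S k).
Proof.
  intros HJ HA HB s Hs.
  destruct (joined_chain_same e A B s HJ Hs) as [H|(s1 & s2 & -> & H1 & H2 & H3)]; auto.
  rewrite length_app. apply HA in H1. lia.
Qed.

Lemma joined_bounded_opp (e : R) (A B : list pt) (k : nat) :
  joined e A B -> bounded (- e) A (S k) -> bounded (- e) B k -> bounded (- e) (A ++ B) (S k).
Proof.
  intros HJ HA HB s Hs.
  destruct (joined_chain_opp e A B s HJ Hs) as [H|(s1 & s2 & -> & H1 & H2 & H3)]; auto.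
  rewrite length_app. apply HB in H2. lia.
Qed.

(** An ordered mixed triple is of type [A], [A], [B] or [A], [B], [B]; every other pattern
    contradicts [left_of]. *)
Lemma general_position_app (A B : list pt) :
  left_of A B -> general_position A -> general_position B ->
  (forall a a' b, In a A -> In a' A -> In b B -> ltx a a' -> cross a a' b <> 0) ->
  (forall a b b', In a A -> In b B -> In b' B -> ltx b b' -> cross a b b' <> 0) ->
  general_position (A ++ B).
Proof.
  intros HL [NA GA] [NB GB] H1 H2. split.
  - rewrite map_app. apply NoDup_app; auto.
    intros x HxA HxB. apply in_map_iff in HxA as (a & <- & Ha).
    apply in_map_iff in HxB as (b & Hb & HbB).
    assert (h := HL a b Ha HbB). unfold ltx in h. lra.
  - intros p q r Hp Hq Hr Hpq Hqr.
    assert (Hba : forall a b, In a A -> In b B -> ltx b a -> False).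
    { intros a b Ha Hb h. assert (h' := HL a b Ha Hb). unfold ltx in *. lra. }
    apply in_app_or in Hp, Hq, Hr.
    destruct Hp as [Hp|Hp], Hq as [Hq|Hq], Hr as [Hr|Hr]; eauto; exfalso; eauto.
Qed.

Lemma joined_general_position (e : R) (A B : list pt) :
  joined e A B -> general_position A -> general_position B -> general_position (A ++ B).
Proof.
  intros (HL & H1 & H2) HA HB.
  apply general_position_app; auto; intros u v w Hu Hv Hw h E.
  - specialize (H1 u v w Hu Hv Hw h). rewrite E in H1. lra.
  - specialize (H2 u v w Hu Hv Hw h). rewrite E in H2. lra.
Qed.

(** * Affine copies *)

(** Covers compositions of translations, vertical shears and vertical scalings; [c] is the vertical
    factor, negative for a reflection. *)
Definition affine_copy (c : R) (f : pt -> pt) : Prop :=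
  (forall p q, fst (f q) - fst (f p) = fst q - fst p) /\
  (forall p q r, cross (f p) (f q) (f r) = c * cross p q r).

Lemma affine_copy_ltx (c : R) (f : pt -> pt) (p q : pt) :
  affine_copy c f -> ltx (f p) (f q) <-> ltx p q.
Proof.
  intros [H _]. specialize (H p q). unfold ltx. split; lra.
Qed.

Lemma chain_map (e c : R) (f : pt -> pt) (X s : list pt) :
  affine_copy c f -> chain e (map f X) s ->
  exists s0, s = map f s0 /\ chain (e * c) X s0.
Proof.
  intros Hf. induction s as [|p s IH]; intros H.
  { exists []. repeat split; try constructor. intros ? []. }
  destruct (IH (chain_tail _ _ _ _ H)) as (s0 & -> & Hi & Hs & Ht).
  destruct H as (Hi' & Hs' & Ht').
  assert (Hp := Hi' p (or_introl eq_refl)).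
  apply in_map_iff in Hp as (p0 & <- & Hp0).
  exists (p0 :: s0). split; [reflexivity|]. repeat split.
  - intros q [<-|Hq]; auto.
  - constructor; [exact Hs|]. inversion Hs' as [|? ? _ Hfa]; subst.
    rewrite Forall_forall in *. intros q Hq.
    apply (affine_copy_ltx c f p0 q Hf). apply Hfa. apply in_map. exact Hq.
  - destruct s0 as [|q [|r s0]]; try exact I. destruct Ht' as [Ht' _]. cbn [map] in Ht'.
    rewrite (proj2 Hf) in Ht'. lra.
  - exact Ht.
Qed.

Lemma turns_scale (e c : R) (s : list pt) : 0 < c -> turns (e * c) s -> turns e s.
Proof.
  intros Hc. induction s as [|p s IH]; [auto|]. intros [H1 H2]. split; [|auto].
  destruct s as [|q [|r s]]; auto.
  apply Rmult_lt_reg_l with c; [exact Hc|]. lra.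
Qed.

Lemma chain_map_pos (e c : R) (f : pt -> pt) (X s : list pt) :
  0 < c -> affine_copy c f -> chain e (map f X) s ->
  exists s0, s = map f s0 /\ chain e X s0.
Proof.
  intros Hc Hf H. destruct (chain_map e c f X s Hf H) as (s0 & -> & H1 & H2 & H3).
  exists s0. repeat split; auto. eapply turns_scale; eauto.
Qed.

Lemma bounded_map (e c : R) (f : pt -> pt) (X : list pt) (k : nat) :
  0 < c -> affine_copy c f -> bounded e X k -> bounded e (map f X) k.
Proof.
  intros Hc Hf H s Hs. destruct (chain_map_pos e c f X s Hc Hf Hs) as (s0 & -> & H0).
  rewrite length_map. auto.
Qed.

Lemma general_position_map (c : R) (f : pt -> pt) (X : list pt) :
  c <> 0 -> affine_copy c f -> general_position X -> general_position (map f X).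
Proof.
  intros Hc Hf [HN HG]. split.
  - clear HG. induction X as [|p X IH]; simpl in *; [constructor|].
    inversion HN as [|? ? Hn HN']; subst. constructor; auto.
    intros Hin. apply Hn. rewrite map_map in Hin. apply in_map_iff in Hin as (q & Hq & Hin).
    apply in_map_iff. exists q. split; [|exact Hin].
    assert (h := proj1 Hf p q). lra.
  - intros p q r Hp Hq Hr Hpq Hqr.
    apply in_map_iff in Hp as (p0 & <- & Hp). apply in_map_iff in Hq as (q0 & <- & Hq).
    apply in_map_iff in Hr as (r0 & <- & Hr).
    rewrite (affine_copy_ltx c f) in Hpq, Hqr by exact Hf.
    rewrite (proj2 Hf). apply Rmult_integral_contrapositive_currified; auto.
Qed.

(** * Placing a copy far to the left *)

(** Finitely many conditions affine in [T] with positive leading coefficient hold together for large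
    [T]; this avoids explicit estimates of how far left a copy must go. *)
Definition eventually (P : R -> Prop) : Prop := exists T0, forall T, T0 <= T -> P T.

Lemma eventually_and (P Q : R -> Prop) :
  eventually P -> eventually Q -> eventually (fun T => P T /\ Q T).
Proof.
  intros [a Ha] [b Hb]. exists (Rmax a b). intros T HT.
  split; [apply Ha|apply Hb]; eapply Rle_trans; try exact HT; [apply Rmax_l|apply Rmax_r].
Qed.

Lemma eventually_all {A : Type} (L : list A) (P : A -> R -> Prop) :
  (forall x, In x L -> eventually (P x)) ->
  eventually (fun T => forall x, In x L -> P x T).
Proof.
  induction L as [|x L IH]; intros H.
  - exists 0. intros T _ y [].
  - assert (HL := IH ltac:(intros; apply H; right; assumption)).
    destruct (eventually_and _ _ (H x (or_introl eq_refl)) HL) as [T0 H0].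
    exists T0. intros T HT y [<-|Hy]; [exact (proj1 (H0 T HT))|exact (proj2 (H0 T HT) y Hy)].
Qed.

Lemma eventually_linear (a b : R) : 0 < a -> eventually (fun T => 0 < a * T + b).
Proof.
  intros Ha. exists ((1 - b) / a). intros T HT.
  apply (Rmult_le_compat_l a) in HT; [|lra].
  replace (a * ((1 - b) / a)) with (1 - b) in HT by (field; lra). lra.
Qed.

Lemma eventually_mono (P Q : R -> Prop) :
  (forall T, P T -> Q T) -> eventually P -> eventually Q.
Proof. intros H [T0 H0]. exists T0. auto. Qed.

Lemma eventually_imp (A : Prop) (P : R -> Prop) :
  {A} + {~ A} -> (A -> eventually P) -> eventually (fun T => A -> P T).
Proof.
  intros [HA|HA] H.
  - destruct (H HA) as [T0 H0]. exists T0. auto.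
  - exists 0. tauto.
Qed.

Lemma ltx_dec (p q : pt) : {ltx p q} + {~ ltx p q}.
Proof. apply Rlt_dec. Qed.

(** After vertical scaling by [h] all slopes of [Y] have absolute value below [d]. The factor is the
    inverse of a large [T]. *)
Lemma flatten (Y : list pt) (d : R) : 0 < d ->
  exists h, 0 < h /\ forall y y', In y Y -> In y' Y -> ltx y y' ->
    h * Rabs (snd y' - snd y) < d * (fst y' - fst y).
Proof.
  intros Hd.
  assert (H : eventually (fun T => 0 < 1 * T + 0 /\
     forall y, In y Y -> forall y', In y' Y -> ltx y y' ->
       0 < (d * (fst y' - fst y)) * T + - Rabs (snd y' - snd y))).
  { apply eventually_and; [apply eventually_linear; lra|].
    apply eventually_all; intros y _. apply eventually_all; intros y' _.
    apply eventually_imp; [apply ltx_dec|]. intros h. apply eventually_linear.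
    apply Rmult_lt_0_compat; unfold ltx in h; lra. }
  destruct H as [T H]. destruct (H T (Rle_refl T)) as [HT H'].
  assert (HT' : 0 < T) by lra.
  exists (/ T). split; [apply Rinv_0_lt_compat; exact HT'|].
  intros y y' Hy Hy' h. specialize (H' y Hy y' Hy' h).
  apply Rmult_lt_reg_l with T; [exact HT'|].
  rewrite <- Rmult_assoc, Rinv_r by lra. lra.
Qed.

(* The copy of [Y] has slopes close to [s] and is seen from [E] in a direction of slope
   close to [t]: it is [Y], flattened vertically by [h], sheared by [s] and translated by
   [(-T, -tT)] with [T] large. All conditions are linear in [T]. *)
Lemma place_left (Y E : list pt) (t s : R) : s <> t ->
  exists f c, 0 < c /\ affine_copy c f /\ left_of (map f Y) E /\
    (forall y e e', In y Y -> In e E -> In e' E ->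
       snd e' - snd e - t * (fst e' - fst e) <> 0 ->
       0 < (snd e' - snd e - t * (fst e' - fst e)) * cross (f y) e e') /\
    (forall y y' e, In y Y -> In y' Y -> In e E -> ltx y y' ->
       0 < (t - s) * cross (f y) (f y') e) /\
    (t < 0 -> forall y e, In y Y -> In e E -> snd e < snd (f y)) /\
    (s < 0 -> forall y y', In y Y -> In y' Y -> ltx y y' -> snd (f y') < snd (f y)).
Proof.
  intros Hst.
  set (d := Rabs (t - s)).
  (* The copy has slopes within [d'] of [s]. The bound [d] keeps them on the same side of [t] as
     [s]; for negative [s] the bound [- s] keeps them negative. *)
  set (d' := if Rlt_dec s 0 then Rmin d (- s) else d).
  assert (Hd : 0 < d) by (apply Rabs_pos_lt; lra).
  assert (Hd' : 0 < d' /\ d' <= d /\ (s < 0 -> d' <= - s)).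
  { unfold d'. destruct (Rlt_dec s 0); [|repeat split; lra].
    repeat split; [apply Rmin_glb_lt; lra|apply Rmin_l|intros _; apply Rmin_r]. }
  destruct Hd' as (Hd'0 & Hd'd & Hd's).
  destruct (flatten Y d' Hd'0) as (h & Hh & HY).
  set (f := fun (T : R) (p : pt) => ((fst p - T, s * fst p + h * snd p - t * T) : pt)).
  assert (HT : eventually (fun T =>
    (forall y, In y Y -> forall e, In e E -> ltx (f T y) e) /\
    (forall y, In y Y -> forall e, In e E -> forall e', In e' E ->
       snd e' - snd e - t * (fst e' - fst e) <> 0 ->
       0 < (snd e' - snd e - t * (fst e' - fst e)) * cross (f T y) e e') /\
    (forall y, In y Y -> forall y', In y' Y -> forall e, In e E -> ltx y y' ->
       0 < (t - s) * cross (f T y) (f T y') e) /\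
    (t < 0 -> forall y, In y Y -> forall e, In e E -> snd e < snd (f T y)))).
  { repeat apply eventually_and.
    - do 2 (apply eventually_all; intros ? _).
      apply eventually_mono with (P := fun T => 0 < 1 * T + (fst x0 - fst x));
        [unfold ltx, f; simpl; intros; lra|apply eventually_linear; lra].
    - apply eventually_all; intros y _. apply eventually_all; intros e _.
      apply eventually_all; intros e' _.
      set (k := snd e' - snd e - t * (fst e' - fst e)).
      apply eventually_imp.
      { destruct (Req_dec_T k 0); [right; tauto|left; assumption]. }
      intros Hk.
      (* The orientation of [f T y], [e], [e'] is affine in [T] with leading coefficient [k];
         multiplying by [k] makes this a square. *)
      apply eventually_mono with (P := fun T => 0 < (k * k) * T +
         k * ((fst e - fst y) * (snd e' - snd e)
              - (snd e - s * fst y - h * snd y) * (fst e' - fst e))).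
      + intros T. unfold cross, f, k; cbn [fst snd]. intros HT.
        eapply Rlt_le_trans; [exact HT|]. right. ring.
      + apply eventually_linear. destruct (Rtotal_order k 0) as [?|[?|?]]; nra.
    - apply eventually_all; intros y Hy. apply eventually_all; intros y' Hy'.
      apply eventually_all; intros e _.
      apply eventually_imp; [apply ltx_dec|]. intros Hyy.
      (* The leading coefficient is positive because flattening makes [h * (snd y' - snd y)] smaller
         in absolute value than [(t - s) * (fst y' - fst y)]. *)
      apply eventually_mono with (P := fun T =>
         0 < ((t - s) * ((t - s) * (fst y' - fst y) - h * (snd y' - snd y))) * T +
         (t - s) * ((fst y' - fst y) * (snd e - s * fst y - h * snd y)
              - (s * (fst y' - fst y) + h * (snd y' - snd y)) * (fst e - fst y))).
      + intros T. unfold cross, f; cbn [fst snd]. intros HT.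
        eapply Rlt_le_trans; [exact HT|]. right. ring.
      + apply eventually_linear.
        specialize (HY y y' Hy Hy' Hyy). unfold ltx in Hyy.
        assert (h1 : h * Rabs (snd y' - snd y) < d * (fst y' - fst y)) by nra.
        clear HY. unfold d in h1.
        assert (h2 : Rabs (h * (snd y' - snd y)) < Rabs (t - s) * (fst y' - fst y)).
        { rewrite Rabs_mult, (Rabs_right h) by lra. exact h1. }
        apply Rabs_def2 in h2.
        destruct (Rcase_abs (t - s)) as [h3|h3].
        * rewrite Rabs_left in h2 by lra. nra.
        * rewrite Rabs_right in h2 by lra. assert (0 < t - s) by lra.
          apply Rmult_lt_0_compat; lra.
    - apply eventually_imp; [apply Rlt_dec|]. intros Ht.
      apply eventually_all; intros y _. apply eventually_all; intros e _.
      apply eventually_mono with (P := fun T => 0 < (- t) * T + (s * fst y + h * snd y - snd e));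
        [unfold f; simpl; intros; lra|apply eventually_linear; lra]. }
  destruct HT as [T HT]. destruct (HT T (Rle_refl T)) as (H1 & H2 & H3 & H4).
  exists (f T), h. split; [exact Hh|]. split; [|split; [|split; [|split; [|split]]]].
  - split; intros; unfold cross, f; simpl; ring.
  - intros a b Ha Hb. apply in_map_iff in Ha as (y & <- & Hy). auto.
  - intros; auto.
  - intros; auto.
  - intros; auto.
  - intros Hs y y' Hy Hy' Hyy. specialize (HY y y' Hy Hy' Hyy). unfold ltx in Hyy.
    specialize (Hd's Hs). assert (h0 := Rle_abs (snd y' - snd y)).
    unfold f; simpl. nra.
Qed.

Lemma exists_steep (E : list pt) :
  exists t, forall e e', In e E -> In e' E -> ltx e e' ->
    snd e' - snd e < t * (fst e' - fst e).
Proof.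
  assert (H : eventually (fun T => forall e, In e E -> forall e', In e' E -> ltx e e' ->
     0 < (fst e' - fst e) * T + - (snd e' - snd e))).
  { do 2 (apply eventually_all; intros ? _).
    apply eventually_imp; [apply ltx_dec|]. intros h. apply eventually_linear.
    unfold ltx in h. lra. }
  destruct H as [t H]. exists t. intros e e' He He' h.
  specialize (H t (Rle_refl t) e He e' He' h). lra.
Qed.

Lemma exists_steep_neg (E : list pt) :
  exists t, t < 0 /\ forall e e', In e E -> In e' E -> ltx e e' ->
    t * (fst e' - fst e) < snd e' - snd e.
Proof.
  assert (H : eventually (fun T => 0 < 1 * T + 0 /\
     forall e, In e E -> forall e', In e' E -> ltx e e' ->
     0 < (fst e' - fst e) * T + (snd e' - snd e))).
  { apply eventually_and; [apply eventually_linear; lra|].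
    do 2 (apply eventually_all; intros ? _).
    apply eventually_imp; [apply ltx_dec|]. intros h. apply eventually_linear.
    unfold ltx in h. lra. }
  destruct H as [t H]. destruct (H t (Rle_refl t)) as [Ht H'].
  exists (- t). split; [lra|]. intros e e' He He' h.
  specialize (H' e He e' He' h). lra.
Qed.

(** Take [t] above all slopes of [B]: far away in direction [t] to the left, the copy falls below
    every line of [B]. Its own slopes are near [t - 1], less than [t], so [B] lies above its
    lines. *)
Lemma join_up (A B : list pt) :
  exists f c, 0 < c /\ affine_copy c f /\ joined 1 (map f A) B.
Proof.
  destruct (exists_steep B) as [t Ht].
  destruct (place_left A B t (t - 1)) as (f & c & Hc & Hf & HL & H1 & H2 & _); [lra|].
  exists f, c. repeat split; auto; try apply Hf.
  - intros a a' b Ha Ha' Hb h.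
    apply in_map_iff in Ha as (y & <- & Hy). apply in_map_iff in Ha' as (y' & <- & Hy').
    rewrite (affine_copy_ltx c f) in h by exact Hf.
    specialize (H2 y y' b Hy Hy' Hb h). lra.
  - intros a b b' Ha Hb Hb' h. apply in_map_iff in Ha as (y & <- & Hy).
    specialize (Ht b b' Hb Hb' h).
    specialize (H1 y b b' Hy Hb Hb' ltac:(lra)). nra.
Qed.

(** Here [t] is negative and below all slopes of [B], and [t / 2] lies strictly between [t] and 0.
    The first inequality reverses the join; negativity yields the descending heights required by
    [core_down]. *)
Lemma join_down (A B : list pt) :
  exists f c, 0 < c /\ affine_copy c f /\ joined (Ropp 1) (map f A) B /\
    (forall a b, In a (map f A) -> In b B -> snd b < snd a) /\
    (forall a a', In a (map f A) -> In a' (map f A) -> ltx a a' -> snd a' < snd a).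
Proof.
  destruct (exists_steep_neg B) as (t & Ht0 & Ht).
  destruct (place_left A B t (t / 2)) as (f & c & Hc & Hf & HL & H1 & H2 & H3 & H4); [lra|].
  exists f, c. split; [exact Hc|]. split; [exact Hf|]. split; [split; [exact HL|split]|split].
  - intros a a' b Ha Ha' Hb h.
    apply in_map_iff in Ha as (y & <- & Hy). apply in_map_iff in Ha' as (y' & <- & Hy').
    rewrite (affine_copy_ltx c f) in h by exact Hf.
    specialize (H2 y y' b Hy Hy' Hb h). nra.
  - intros a b b' Ha Hb Hb' h. apply in_map_iff in Ha as (y & <- & Hy).
    specialize (Ht b b' Hb Hb' h).
    specialize (H1 y b b' Hy Hb Hb' ltac:(lra)). nra.
  - intros a b Ha Hb. apply in_map_iff in Ha as (y & <- & Hy). auto.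
  - intros a a' Ha Ha' h.
    apply in_map_iff in Ha as (y & <- & Hy). apply in_map_iff in Ha' as (y' & <- & Hy').
    rewrite (affine_copy_ltx c f) in h by exact Hf.
    apply H4; auto. lra.
Qed.

(** * The Erdős–Szekeres sets *)

Lemma binom_large (n k : nat) : (n < k)%nat -> binom n k = 0%nat.
Proof.
  revert k. induction n as [|n IH]; intros [|k] H; simpl; try lia.
  rewrite !IH by lia. reflexivity.
Qed.

Lemma binom_diag (n : nat) : binom n n = 1%nat.
Proof.
  induction n as [|n IH]; simpl; [reflexivity|]. rewrite IH, binom_large by lia. reflexivity.
Qed.

Lemma binom_n_0 (n : nat) : binom n 0 = 1%nat.
Proof. destruct n; reflexivity. Qed.

Lemma binom_n_1 (n : nat) : binom n 1 = n.
Proof.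
  induction n as [|n IH]; simpl; [reflexivity|]. rewrite IH, binom_n_0. reflexivity.
Qed.

Lemma binom_sym (a b : nat) : binom (a + b) a = binom (b + a) b.
Proof.
  revert b. induction a as [|a IHa]; intros b.
  { rewrite Nat.add_0_r, binom_diag. apply binom_n_0. }
  induction b as [|b IHb].
  { rewrite Nat.add_0_r, binom_diag. symmetry. apply binom_n_0. }
  change (S a + S b)%nat with (S (a + S b)). change (S b + S a)%nat with (S (b + S a)).
  simpl binom. rewrite (IHa (S b)).
  replace (a + S b)%nat with (S a + b)%nat by lia. rewrite IHb.
  replace (S b + a)%nat with (b + S a)%nat by lia. lia.
Qed.

Lemma bounded_length (e : R) (X : list pt) (k : nat) : (length X <= k)%nat -> bounded e X k.
Proof.
  intros H s (Hi & Hs & _). assert (h := sorted_length_le X s Hi Hs). lia.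
Qed.

Lemma general_position_single (p : pt) : general_position [p].
Proof.
  split; [repeat constructor; simpl; tauto|].
  intros a b c [<-|[]] [<-|[]] _ h. unfold ltx in h. lra.
Qed.

(** With u = l-2 and v = m-2 this is the extremal set without l-cups and m-caps. The join realizes
    Pascal's rule: a cup meeting [A] gains at most one point of [B], a cap meeting [B] at most one
    point of [A]. *)
Lemma erdos_szekeres_set (u v : nat) :
  exists X, length X = binom (u + v) u /\ general_position X /\
    bounded 1 X (S u) /\ bounded (Ropp 1) X (S v).
Proof.
  revert v. induction u as [|u IHu]; intros v.
  { exists [pd]. rewrite binom_n_0.
    repeat split; try apply general_position_single; apply bounded_length; simpl; lia. }
  induction v as [|v IHv].
  { exists [pd]. rewrite Nat.add_0_r, binom_diag.
    repeat split; try apply general_position_single; apply bounded_length; simpl; lia. }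
  destruct (IHu (S v)) as (A & LA & GA & UA & VA).
  destruct IHv as (B & LB & GB & UB & VB).
  destruct (join_up A B) as (f & c & Hc & Hf & HJ).
  exists (map f A ++ B). split; [|split; [|split]].
  - rewrite length_app, length_map, LA, LB. change (S u + S v)%nat with (S (u + S v)).
    simpl binom. replace (u + S v)%nat with (S u + v)%nat by lia. reflexivity.
  - apply (joined_general_position _ _ _ HJ); [apply (general_position_map c); [lra|auto..]|auto].
  - eapply joined_bounded_same; eauto. eapply bounded_map; eauto.
  - eapply joined_bounded_opp; eauto. eapply bounded_map; eauto.
Qed.

(** * The middle part *)

(* [p :: Z] is a cap of [j + 3] points, but [p] has smaller height than [Z], while all other
   slopes are negative: points far to the left see no cap in [E] that starts at [p]. *)
Record core (i j : nat) (Y : list pt) (p : pt) (Z : list pt) : Prop := {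
  core_gp : general_position (Y ++ p :: Z);
  core_left : left_of Y (p :: Z);
  core_first : left_of [p] Z;
  core_down : forall e e', In e (Y ++ p :: Z) -> In e' (Y ++ p :: Z) ->
    ltx e e' -> e <> p -> snd e' < snd e;
  core_up : forall z, In z Z -> snd p < snd z;
  core_cups : bounded 1 (Y ++ p :: Z) (i + 2);
  core_caps : forall x s, x <> p -> chain (Ropp 1) (Y ++ p :: Z) (x :: s) ->
    (length (x :: s) <= j + 2)%nat;
  core_lengthY : (length Y + (j + 2) = binom (i + j + 2) (i + 1))%nat;
  core_lengthZ : length Z = (j + 2)%nat
}.

Lemma no_left_turn_bounded (X : list pt) :
  (forall p q r, In p X -> In q X -> In r X -> ltx p q -> ltx q r -> cross p q r < 0) ->
  bounded 1 X 2.
Proof.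
  intros H s (Hi & Hs & Ht). destruct s as [|p [|q [|r s]]]; simpl; try lia. exfalso.
  assert (Hpq := sorted_head _ _ _ Hs).
  inversion Hs as [|? ? Hs' _]; subst. assert (Hqr := sorted_head _ _ _ Hs').
  assert (h := H p q r (Hi p ltac:(simpl; tauto)) (Hi q ltac:(simpl; tauto))
                 (Hi r ltac:(simpl; tauto)) Hpq Hqr).
  destruct Ht as [Ht _]. lra.
Qed.

(** For [i = 0] the required size leaves [Y] empty. Take [p] to be the origin and [Z] on a downward
    parabola at abscissae 1, ..., j+2. *)
Lemma core_base (j : nat) : exists Y p Z, core 0 j Y p Z.
Proof.
  (* [M] exceeds the square of every abscissa in [Z], so [Z] lies above the origin. *)
  set (M := (INR (j + 2) + 1) ^ 2).
  set (z := fun k : nat => ((INR k, M - INR k ^ 2) : pt)).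
  set (Z := map z (seq 1 (j + 2))).
  assert (HZ : forall q, In q Z -> exists a, 0 < a /\ a ^ 2 < M /\ q = (a, M - a ^ 2)).
  { intros q Hq. apply in_map_iff in Hq as (k & <- & Hk). apply in_seq in Hk.
    assert (1 <= INR k) by (apply (le_INR 1); lia).
    assert (INR k <= INR (j + 2)) by (apply le_INR; lia).
    exists (INR k). repeat split; unfold M; nra. }
  assert (H0 : left_of [pd] Z).
  { intros a b [<-|[]] Hb. destruct (HZ b Hb) as (k & Hk & _ & ->). exact Hk. }
  assert (Hneg : forall p q r, In p (pd :: Z) -> In q (pd :: Z) -> In r (pd :: Z) ->
             ltx p q -> ltx q r -> cross p q r < 0).
  { intros p q r Hp Hq Hr Hpq Hqr.
    destruct Hq as [<-|Hq].
    { exfalso. unfold ltx in Hpq; simpl in Hpq. destruct Hp as [<-|Hp]; [simpl in Hpq; lra|].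
      destruct (HZ p Hp) as (k & Hk & _ & ->). simpl in Hpq. lra. }
    destruct Hr as [<-|Hr].
    { exfalso. unfold ltx in Hqr; simpl in Hqr.
      destruct (HZ q Hq) as (k & Hk & _ & ->). simpl in Hqr. lra. }
    destruct (HZ q Hq) as (b & Hb & HbM & ->). destruct (HZ r Hr) as (c & Hc & HcM & ->).
    unfold ltx in *; simpl fst in *.
    destruct Hp as [<-|Hp].
    - simpl fst in *.
      replace (cross pd (b, M - b ^ 2) (c, M - c ^ 2)) with (- ((c - b) * (M + b * c)))
        by (unfold cross, pd; simpl; ring).
      assert (0 < (c - b) * (M + b * c)); [|lra].
      apply Rmult_lt_0_compat; [lra|]. assert (0 < b * c) by (apply Rmult_lt_0_compat; lra). nra.
    - destruct (HZ p Hp) as (a & Ha & HaM & ->). simpl fst in *.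
      replace (cross (a, M - a ^ 2) (b, M - b ^ 2) (c, M - c ^ 2))
        with (- ((b - a) * (c - a) * (c - b))) by (unfold cross; simpl; ring).
      assert (0 < (b - a) * (c - a) * (c - b)); [|lra].
      repeat apply Rmult_lt_0_compat; lra. }
  exists [], pd, Z. constructor.
  - split.
    + simpl. constructor.
      * intros Hin. apply in_map_iff in Hin as (q & Hq & Hin).
        destruct (HZ q Hin) as (k & Hk & _ & ->). simpl in Hq. lra.
      * unfold Z. rewrite map_map. simpl.
        apply NoDup_map_NoDup_ForallPairs; [|apply seq_NoDup].
        intros a b _ _. apply INR_eq.
    + intros p q r Hp Hq Hr Hpq Hqr. specialize (Hneg p q r Hp Hq Hr Hpq Hqr). lra.
  - intros a b [].
  - exact H0.
  - intros e e' He He' h Hne. destruct He as [<-|He]; [congruence|].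
    destruct (HZ e He) as (a & Ha & HaM & ->).
    destruct He' as [<-|He'].
    { unfold ltx in h. simpl in h. lra. }
    destruct (HZ e' He') as (b & Hb & HbM & ->). unfold ltx in h. simpl in *. nra.
  - intros q Hq. destruct (HZ q Hq) as (a & Ha & HaM & ->). simpl in *. lra.
  - apply no_left_turn_bounded. exact Hneg.
  - intros x s Hx (Hi & Hs & _).
    rewrite <- (length_seq (j + 2) 1), <- (length_map z). apply sorted_length_le; [|exact Hs].
    (* A cap that starts away from [p] stays in [Z], since [p] is to the left of [Z]. *)
    assert (HxZ : In x Z) by (destruct (Hi x (or_introl eq_refl)); [congruence|assumption]).
    intros q [<-|Hq]; [exact HxZ|].
    destruct (Hi q (or_intror Hq)) as [<-|]; [exfalso|assumption].
    inversion Hs as [|? ? _ Hf]; subst. rewrite Forall_forall in Hf.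
    specialize (Hf pd Hq). assert (h := H0 pd x (or_introl eq_refl) HxZ). unfold ltx in *. lra.
  - simpl length. change (0 + 1)%nat with 1%nat. rewrite binom_n_1. lia.
  - unfold Z. rewrite length_map, length_seq. reflexivity.
Qed.

(** Passing from [i] to [i + 1] puts an extremal set [W] of binom(i+j+2, i+2) points to the left of
    [Y], joined with sign -1; sizes add up by Pascal's rule. A cup meeting the old core gains at
    most one point of [W]. *)
Lemma core_exists (i j : nat) : exists Y p Z, core i j Y p Z.
Proof.
  induction i as [|i (Y & p & Z & HC)]; [apply core_base|].
  destruct (erdos_szekeres_set (i + 2) j) as (W & LW & GW & UW & VW).
  destruct (join_down W (Y ++ p :: Z)) as (f & c & Hc & Hf & HJ & H1 & H2).
  assert (HL := proj1 HJ).
  exists (map f W ++ Y), p, Z. destruct HC. constructor; rewrite <- ?app_assoc; auto.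
  - apply (joined_general_position _ _ _ HJ); [apply (general_position_map c); [lra|auto..]|auto].
  - intros a b Ha Hb. apply in_app_or in Ha as [Ha|Ha]; auto.
    apply HL; auto. apply in_or_app. auto.
  - intros e e' He He' h Hne.
    apply in_app_or in He as [He|He]; apply in_app_or in He' as [He'|He']; auto.
    exfalso. specialize (HL e' e He' He). unfold ltx in *. lra.
  - rewrite <- (Ropp_involutive 1). replace (S i + 2)%nat with (S (i + 2)) by lia.
    eapply joined_bounded_opp; eauto; rewrite Ropp_involutive; auto.
    eapply bounded_map; eauto.
  (* Either the cap lies in the old core and still starts away from [p], or it has at most j+1
     points in the copy of [W] and at most one more. *)
  - intros x s Hx Hs.
    destruct (joined_chain_same _ _ _ _ HJ Hs) as [H|(s1 & s2 & E & Hs1 & _ & Hs2)]; auto.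
    rewrite E, length_app.
    apply (bounded_map _ c f W (S j) Hc Hf VW) in Hs1. lia.
  - rewrite length_app, length_map, LW.
    replace (S i + j + 2)%nat with (S (i + j + 2)) by lia.
    replace (S i + 1)%nat with (S (i + 1)) by lia. simpl binom.
    replace (i + 2 + j)%nat with (i + j + 2)%nat by lia.
    replace (S (i + 1)) with (i + 2)%nat by lia. lia.
Qed.

(** * The full set *)

(** The products say that the barycentric coordinates of [q] are positive, whichever way the
    triangle is oriented. *)
Definition strictly_inside (u v w q : pt) : Prop :=
  0 < cross u v w * cross q v w /\ 0 < cross u v w * cross u q w /\
  0 < cross u v w * cross u v q.

(** Here [m] is the greatest length allowed to opposite chains, one less than the forbidden length.
    Triangles on points of the chain certify interior points in a form that a reflection
    preserves. *)
Definition sparse_avoiding (e : R) (X : list pt) (l m N : nat) : Prop :=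
  general_position X /\ bounded (- e) X m /\
  forall s, chain e X s -> length s = l ->
    exists Q, NoDup Q /\ length Q = N /\ incl Q X /\
      forall q, In q Q -> exists u v w, In u s /\ In v s /\ In w s /\ strictly_inside u v w q.

(** Direction 0 lets the far copy of [A] see the core horizontally, so the turn at [a], [e], [e']
    has the sign of the height difference: down except from [p], up from [p] to [Z]. Slopes near -1
    put the core above all lines of the copy. *)
Lemma place_level (A : list pt) (i j : nat) (Y : list pt) (p : pt) (Z : list pt) :
  core i j Y p Z ->
  exists f c, 0 < c /\ affine_copy c f /\ left_of (map f A) (Y ++ p :: Z) /\
    (forall a a' e, In a (map f A) -> In a' (map f A) -> In e (Y ++ p :: Z) ->
       ltx a a' -> 0 < cross a a' e) /\
    (forall a e e', In a (map f A) -> In e (Y ++ p :: Z) -> In e' (Y ++ p :: Z) ->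
       ltx e e' -> e <> p -> cross a e e' < 0) /\
    (forall a z, In a (map f A) -> In z Z -> 0 < cross a p z).
Proof.
  intros HC. destruct (place_left A (Y ++ p :: Z) 0 (-1))
    as (f & c & Hc & Hf & HL & H1 & H2 & _); [lra|].
  exists f, c. split; [exact Hc|]. split; [exact Hf|]. split; [exact HL|]. split; [|split].
  - intros a a' e Ha Ha' He h.
    apply in_map_iff in Ha as (y & <- & Hy). apply in_map_iff in Ha' as (y' & <- & Hy').
    rewrite (affine_copy_ltx c f) in h by exact Hf.
    specialize (H2 y y' e Hy Hy' He h). lra.
  - intros a e e' Ha He He' h Hne. apply in_map_iff in Ha as (y & <- & Hy).
    assert (hd := core_down _ _ _ _ _ HC e e' He He' h Hne).
    specialize (H1 y e e' Hy He He' ltac:(lra)). nra.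
  - intros a z Ha Hz. apply in_map_iff in Ha as (y & <- & Hy).
    assert (hu := core_up _ _ _ _ _ HC z Hz).
    specialize (H1 y p z Hy ltac:(apply in_or_app; simpl; tauto)
                  ltac:(apply in_or_app; simpl; tauto) ltac:(lra)). nra.
Qed.

Lemma core_right (i j : nat) (Y : list pt) (p : pt) (Z : list pt) (e : pt) :
  core i j Y p Z -> In e (Y ++ p :: Z) -> ltx p e -> In e Z.
Proof.
  intros HC He h. apply in_app_or in He as [He|[<-|He]]; auto; exfalso.
  - assert (h' := core_left _ _ _ _ _ HC e p He (or_introl eq_refl)). unfold ltx in *. lra.
  - unfold ltx in h. lra.
Qed.

Lemma pt_eq_dec (p q : pt) : {p = q} + {p <> q}.
Proof.
  destruct p as [x y], q as [x' y'].
  destruct (Req_dec_T x x') as [->|Hx]; [|right; congruence].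
  destruct (Req_dec_T y y') as [->|Hy]; [left; reflexivity|right; congruence].
Qed.

(** Here i = l-4 and j = m-4, and [N] is the size of [Y]. The set is (A / E) / B with A = X_{l-2,m},
    B = X_{l,m-1} and the core E as middle part, one point larger than X_{l-1,m-1}. *)
Lemma avoiding_set (i j : nat) :
  exists X N, length X = (binom (i + j + 4) (i + 2) + 1)%nat /\
    (N + (j + 2) = binom (i + j + 2) (i + 1))%nat /\
    sparse_avoiding 1 X (i + 4) (j + 3) N.
Proof.
  destruct (core_exists i j) as (Y & p & Z & HC).
  destruct (erdos_szekeres_set i (j + 2)) as (A0 & LA & GA & UA & VA).
  destruct (erdos_szekeres_set (i + 2) (j + 1)) as (B & LB & GB & UB & VB).
  destruct (place_level A0 i j Y p Z HC) as (f & c & Hc & Hf & HL & H1 & H2 & H3).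
  set (A := map f A0) in *. set (E := Y ++ p :: Z) in *.
  apply (bounded_map _ c f _ _ Hc Hf) in UA, VA. fold A in UA, VA.
  apply (general_position_map c f) in GA; [|lra|exact Hf]. fold A in GA.
  assert (LA' : length A = binom (i + (j + 2)) i) by (unfold A; rewrite length_map; exact LA).
  clearbody A. clear A0 LA f c Hc Hf.
  assert (HpE : In p E) by (apply in_or_app; simpl; tauto).
  assert (HpZ : forall e, In e E -> ltx p e -> In e Z)
    by (intros e; apply (core_right i j Y p Z e HC)).
  assert (GAE : general_position (A ++ E)).
  { apply general_position_app; auto; [apply HC| |].
    - intros a a' e Ha Ha' He h. specialize (H1 a a' e Ha Ha' He h). lra.
    - intros a e e' Ha He He' h.
      destruct (pt_eq_dec e p) as [->|D].
      + specialize (H3 a e' Ha (HpZ e' He' h)). lra.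
      + specialize (H2 a e e' Ha He He' h D). lra. }
  (* A cup of l-1 points in the left two parts must consist of i+1 points of [A], then [p], then one
     point of [Z]: two points of [E] after a point of [A] force the first to be [p]. *)
  assert (cups : forall s, chain 1 (A ++ E) s -> (i + 3 <= length s)%nat ->
            length s = (i + 3)%nat /\ In p s /\ exists a, In a A /\ In a s).
  { intros s Hs Hl. destruct (chain_split 1 A E s HL Hs) as (s1 & s2 & -> & HA & HE).
    destruct Hs as (_ & _ & Ht). rewrite length_app in *.
    assert (hA := UA s1 HA). assert (hE := core_cups _ _ _ _ _ HC s2 HE).
    destruct s1 as [|a s1]; [simpl in Hl; lia|].
    destruct s2 as [|e [|e' s2]]; try (simpl in *; lia).
    destruct HA as (HiA & _ & _). destruct HE as (HiE & HsE & HtE).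
    assert (Hee := sorted_head _ _ _ HsE).
    assert (He := HiE e ltac:(simpl; tauto)). assert (He' := HiE e' ltac:(simpl; tauto)).
    assert (D : e = p).
    { destruct (turns_at_right 1 (a :: s1) s2 e e' ltac:(discriminate) Ht) as (b & Hb & Hx).
      destruct (pt_eq_dec e p) as [|D]; [assumption|exfalso].
      specialize (H2 b e e' (HiA b Hb) He He' Hee D). lra. }
    (* A third point of [E] is impossible: the path rises from [p] to [e'] and then descends, a
       right turn. *)
    subst e. assert (s2 = []) as ->.
    { destruct s2 as [|e'' s2]; [reflexivity|exfalso].
      assert (He'' := HiE e'' ltac:(simpl; tauto)).
      inversion HsE as [|? ? HsE' _]; subst. assert (Hee' := sorted_head _ _ _ HsE').
      assert (h1 := core_up _ _ _ _ _ HC e' (HpZ e' He' Hee)).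
      assert (Hne : e' <> p) by (intros ->; unfold ltx in Hee; lra).
      assert (h2 := core_down _ _ _ _ _ HC e' e'' He' He'' Hee' Hne).
      destruct HtE as [HtE _]. unfold cross, ltx in *. nra. }
    simpl length in *. split; [lia|]. split; [apply in_or_app; simpl; tauto|].
    exists a. split; [apply HiA; simpl; tauto|simpl; tauto]. }
  (* A cap meeting [E] has at most one point of [A]. If it enters [E] away from [p], [core_caps]
     leaves room for that point; if it enters at [p] and continues, a point of [A] before would make
     a left turn. *)
  assert (caps : bounded (Ropp 1) (A ++ E) (j + 3)).
  { intros s Hs. destruct (chain_split (Ropp 1) A E s HL Hs) as (s1 & s2 & -> & HA & HE).
    destruct Hs as (_ & _ & Ht). rewrite length_app in *.
    assert (hA := VA s1 HA).
    destruct s2 as [|e s2]; [simpl; lia|].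
    assert (HiE := proj1 HE). assert (He := HiE e ltac:(simpl; tauto)).
    assert (h1 : (length s1 <= 1)%nat).
    { destruct (le_lt_dec (length s1) 1) as [|Hl]; [assumption|exfalso].
      destruct HA as (HiA & HsA & _).
      destruct (turns_at_left _ s1 s2 e Hl HsA Ht) as (a & a' & Ha & Ha' & Haa & Hx).
      specialize (H1 a a' e (HiA _ Ha) (HiA _ Ha') He Haa). lra. }
    destruct (pt_eq_dec e p) as [->|D].
    2:{ assert (h := core_caps _ _ _ _ _ HC e s2 D HE). lia. }
    destruct s2 as [|e' s2]; [simpl; lia|].
    assert (Hee := sorted_head _ _ _ (proj1 (proj2 HE))).
    assert (He' := HiE e' ltac:(simpl; tauto)).
    destruct s1 as [|a s1].
    - assert (Hne : e' <> p) by (intros ->; unfold ltx in Hee; lra).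
      assert (h := core_caps _ _ _ _ _ HC e' s2 Hne (chain_tail _ _ _ _ HE)). simpl in *. lia.
    - exfalso.
      destruct (turns_at_right _ (a :: s1) s2 p e' ltac:(discriminate) Ht) as (b & Hb & Hx).
      specialize (H3 b e' (proj1 HA b Hb) (HpZ e' He' Hee)). lra. }
  destruct (join_up (A ++ E) B) as (g & d & Hd & Hg & HJ).
  exists (map g (A ++ E) ++ B), (length Y). split; [|split].
  - rewrite length_app, length_map, length_app, LA', LB. unfold E. rewrite length_app.
    simpl length. rewrite (core_lengthZ _ _ _ _ _ HC).
    assert (h := core_lengthY _ _ _ _ _ HC).
    replace (i + j + 4)%nat with (S (S (i + j + 2))) by lia.
    replace (i + 2)%nat with (S (S i)) by lia. simpl binom.
    replace (S (S (i + (j + 1)))) with (S (i + j + 2)) by lia. simpl binom.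
    replace (i + (j + 2))%nat with (i + j + 2)%nat by lia.
    replace (i + (j + 1))%nat with (i + j + 1)%nat by lia.
    replace (i + 1)%nat with (S i) in h by lia.
    replace (i + j + 2)%nat with (S (i + j + 1)) in * by lia.
    simpl binom in *. lia.
  - apply (core_lengthY _ _ _ _ _ HC).
  - split; [|split].
    + apply (joined_general_position _ _ _ HJ); [apply (general_position_map d); [lra|auto..]|auto].
    + replace (j + 3)%nat with (S (j + 2)) by lia. eapply joined_bounded_opp; eauto.
      * eapply bounded_map; eauto. replace (S (j + 2)) with (j + 3)%nat by lia. exact caps.
      * replace (j + 2)%nat with (S (j + 1)) by lia. exact VB.
    + intros s Hs Hl.
      destruct (joined_chain_same _ _ _ _ HJ Hs) as [H|(s1 & s2 & -> & Hs1 & Hs2 & Hl2)].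
      { apply UB in H. lia. }
      destruct (chain_map_pos 1 d g _ s1 Hd Hg Hs1) as (s0 & -> & Hs0).
      rewrite length_app, length_map in Hl.
      (* At most one point lies in [B], so at least i+3 remain and the description of long cups
         applies; it leaves exactly one point [b] in [B]. *)
      destruct (cups s0 Hs0 ltac:(lia)) as (Hl0 & Hp & a & HaA & Ha).
      destruct s2 as [|b [|b' s2]]; simpl in Hl, Hl2; try lia.
      assert (Hb := proj1 Hs2 b (or_introl eq_refl)).
      exists (map g Y). split; [|split; [apply length_map|split]].
      * assert (HN : NoDup (map fst (map g Y))).
        { destruct GAE as [HN _]. unfold E in HN. rewrite !map_app in HN.
          apply NoDup_app_remove_l, NoDup_app_remove_r in HN.
          assert (GY : general_position (map g Y)); [|apply GY].
          eapply general_position_map; [|exact Hg|]; [lra|]. split; [exact HN|].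
          intros u v w Hu Hv Hw. apply (core_gp _ _ _ _ _ HC); apply in_or_app; auto. }
        apply NoDup_map_inv in HN. exact HN.
      * apply incl_appl. apply incl_map. intros q Hq. apply in_or_app. right.
        apply in_or_app. auto.
      * intros q Hq. apply in_map_iff in Hq as (y & <- & Hy).
        assert (HyE : In y E) by (apply in_or_app; auto).
        assert (hay : ltx a y) by (apply HL; auto).
        assert (hyp : ltx y p) by (apply (core_left _ _ _ _ _ HC); simpl; auto).
        assert (hap : ltx a p) by (apply HL; auto).
        assert (Hyp : y <> p) by (intros ->; unfold ltx in hyp; lra).
        (* This puts [y] above the line through [a] and [p]. The other two sides of the triangle
           [g a], [g p], [b] follow because [b] lies above all lines of the left part. *)
        assert (k := H2 a y p HaA HyE HpE hyp Hyp).
        exists (g a), (g p), b.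
        split; [apply in_or_app; left; apply in_map; exact Ha|].
        split; [apply in_or_app; left; apply in_map; exact Hp|].
        split; [apply in_or_app; simpl; tauto|].
        assert (IA : In (g a) (map g (A ++ E))) by (apply in_map, in_or_app; auto).
        assert (IY : In (g y) (map g (A ++ E))) by (apply in_map, in_or_app; auto).
        assert (IP : In (g p) (map g (A ++ E))) by (apply in_map, in_or_app; auto).
        destruct HJ as (_ & HJ & _).
        rewrite <- (affine_copy_ltx d g) in hay, hyp, hap by exact Hg.
        assert (k1 := HJ _ _ b IA IP Hb hap). assert (k2 := HJ _ _ b IY IP Hb hyp).
        assert (k3 := HJ _ _ b IA IY Hb hay).
        assert (k4 : 0 < cross (g a) (g p) (g y)).
        { rewrite (proj2 Hg). apply Rmult_lt_0_compat; [exact Hd|].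
          unfold cross in *. lra. }
        repeat split; apply Rmult_lt_0_compat; lra.
Qed.

(** * Reflection in the horizontal axis *)

Definition reflect (p : pt) : pt := (fst p, - snd p).

Lemma affine_copy_reflect : affine_copy (Ropp 1) reflect.
Proof. split; intros; unfold cross; simpl; ring. Qed.

Lemma chain_reflect (e : R) (X s : list pt) :
  chain (- e) (map reflect X) s -> exists s0, s = map reflect s0 /\ chain e X s0.
Proof.
  intros H. destruct (chain_map _ _ _ _ _ affine_copy_reflect H) as (s0 & -> & H0).
  exists s0. split; [reflexivity|]. replace e with (- e * Ropp 1) by ring. exact H0.
Qed.

Lemma reflect_involutive (p : pt) : reflect (reflect p) = p.
Proof. destruct p. unfold reflect; simpl. rewrite Ropp_involutive. reflexivity. Qed.

Lemma sparse_avoiding_reflect (e : R) (X : list pt) (l m N : nat) :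
  sparse_avoiding e X l m N -> sparse_avoiding (- e) (map reflect X) l m N.
Proof.
  intros (HG & HB & HQ). split; [|split].
  - apply (general_position_map (Ropp 1)); auto using affine_copy_reflect. lra.
  - intros s Hs. destruct (chain_reflect _ _ _ Hs) as (s0 & -> & H0).
    rewrite length_map. auto.
  - intros s Hs Hl. destruct (chain_reflect _ _ _ Hs) as (s0 & -> & H0).
    rewrite length_map in Hl. destruct (HQ s0 H0 Hl) as (Q & HN & HL & HI & Hq).
    exists (map reflect Q). split; [|split; [|split]].
    + apply NoDup_map_NoDup_ForallPairs; [|exact HN].
      intros a b _ _ h. rewrite <- (reflect_involutive a), h. apply reflect_involutive.
    + rewrite length_map. exact HL.
    + apply incl_map. exact HI.
    + intros q Hin. apply in_map_iff in Hin as (q0 & <- & Hin).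
      destruct (Hq q0 Hin) as (u & v & w & Hu & Hv & Hw & H1 & H2 & H3).
      exists (reflect u), (reflect v), (reflect w).
      (* Both factors of each product change sign, so strict interiority survives the reflection. *)
      repeat split; try (apply in_map; assumption);
        rewrite !(proj2 affine_copy_reflect); lra.
Qed.

(** * Interior points of triangles *)

Lemma in_conv_vertex (s : list pt) (p : pt) : In p s -> in_conv s p.
Proof.
  assert (Z : forall t : list pt, exists w, length w = length t /\ Forall (fun c => 0 <= c) w /\
    fold_right Rplus 0 w = 0 /\
    fold_right Rplus 0 (map (fun c => fst c * fst (snd c)) (combine w t)) = 0 /\
    fold_right Rplus 0 (map (fun c => fst c * snd (snd c)) (combine w t)) = 0).
  { induction t as [|q t (w & H1 & H2 & H3 & H4 & H5)]; [exists []; simpl; auto|].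
    exists (0 :: w). simpl. rewrite H1, H3, H4, H5.
    repeat split; try constructor; auto; lra. }
  induction s as [|q s IH]; intros [].
  - subst q. destruct (Z s) as (w & H1 & H2 & H3 & H4 & H5). exists (1 :: w). simpl.
    rewrite H1, H3, H4, H5. repeat split; try constructor; auto; lra.
  - destruct (IH H) as (w & H1 & H2 & H3 & H4 & H5). exists (0 :: w). simpl.
    rewrite H1, H3, <- H4, <- H5. repeat split; try constructor; auto; lra.
Qed.

(** Weights are combined entry by entry; a general [g] treats both coordinates at once. *)
Lemma combine_weights (s : list pt) (w w' : list R) (a b : R) :
  0 <= a -> 0 <= b -> length w = length s -> length w' = length s ->
  Forall (fun t => 0 <= t) w -> Forall (fun t => 0 <= t) w' ->
  exists v, length v = length s /\ Forall (fun t => 0 <= t) v /\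
    fold_right Rplus 0 v = a * fold_right Rplus 0 w + b * fold_right Rplus 0 w' /\
    forall g : pt -> R,
      fold_right Rplus 0 (map (fun c => fst c * g (snd c)) (combine v s)) =
      a * fold_right Rplus 0 (map (fun c => fst c * g (snd c)) (combine w s)) +
      b * fold_right Rplus 0 (map (fun c => fst c * g (snd c)) (combine w' s)).
Proof.
  intros Ha Hb. revert w w'.
  induction s as [|q s IH]; intros [|x w] [|x' w'] L L' F F'; try discriminate.
  - exists []. simpl. repeat split; auto; intros; lra.
  - inversion F; inversion F'; subst.
    destruct (IH w w') as (v & K3 & K4 & K5 & K6); auto.
    exists (a * x + b * x' :: v). simpl. rewrite K3, K5.
    repeat split; [constructor; [nra|auto]|lra|]. intros g. rewrite K6. lra.
Qed.

Lemma in_conv_segment (s : list pt) (p q r : pt) (a b : R) :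
  0 <= a -> 0 <= b -> a + b = 1 -> in_conv s p -> in_conv s q ->
  fst r = a * fst p + b * fst q -> snd r = a * snd p + b * snd q -> in_conv s r.
Proof.
  intros Ha Hb Hab (w & H1 & H2 & H3 & H4 & H5) (w' & H1' & H2' & H3' & H4' & H5') Hf Hs.
  destruct (combine_weights s w w' a b) as (v & K1 & K2 & K3 & K4); auto.
  exists v. split; [exact K1|]. split; [exact K2|]. split; [|split].
  - rewrite K3, H3, H3'. lra.
  - rewrite Hf, H4, H4'. symmetry. apply (K4 fst).
  - rewrite Hs, H5, H5'. symmetry. apply (K4 snd).
Qed.

Lemma in_conv_triangle (s : list pt) (u v w q : pt) (a b c : R) :
  In u s -> In v s -> In w s -> 0 <= a -> 0 <= b -> 0 <= c -> a + b + c = 1 ->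
  fst q = a * fst u + b * fst v + c * fst w ->
  snd q = a * snd u + b * snd v + c * snd w -> in_conv s q.
Proof.
  intros Hu Hv Hw Ha Hb Hc Habc Hf Hs.
  apply in_conv_vertex in Hu, Hv, Hw.
  (* Otherwise [a + b] is nonzero and [q] lies on the segment from [w] to a point [r] of the side
     [u v]. *)
  destruct (Req_dec_T c 1) as [->|Hc1].
  { assert (a = 0) by lra. assert (b = 0) by lra. subst a b.
    apply (in_conv_segment s u w q 0 1); auto; lra. }
  set (r := (((a * fst u + b * fst v) / (a + b)), ((a * snd u + b * snd v) / (a + b)))).
  apply (in_conv_segment s r w q (a + b) c); auto; try lra.
  - apply (in_conv_segment s u v r (a / (a + b)) (b / (a + b))); auto;
      try (apply Rmult_le_pos; [lra|apply Rlt_le, Rinv_0_lt_compat; lra]);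
      try (unfold r; simpl; field; lra); field; lra.
  - rewrite Hf. unfold r; simpl. field. lra.
  - rewrite Hs. unfold r; simpl. field. lra.
Qed.

(** With eps = k / (|a| + |b| + 1) the linear part changes the value by at most (|a| + |b|) eps,
    which is less than [k]. *)
Lemma affine_nonneg_near (k a b : R) : 0 < k ->
  exists eps, 0 < eps /\ forall x y, x ^ 2 + y ^ 2 < eps ^ 2 -> 0 <= k + a * x + b * y.
Proof.
  intros Hk. set (K := Rabs a + Rabs b + 1).
  assert (HK : 0 < K) by (assert (h := Rabs_pos a); assert (h' := Rabs_pos b); unfold K; lra).
  exists (k / K). split; [apply Rdiv_lt_0_compat; assumption|].
  intros x y Hxy. set (e := k / K) in *.
  assert (He : 0 < e) by (apply Rdiv_lt_0_compat; assumption).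
  assert (Hke : k = e * K) by (unfold e; field; lra).
  assert (Hx : Rabs x <= e) by (apply Rabs_le; nra).
  assert (Hy : Rabs y <= e) by (apply Rabs_le; nra).
  assert (h1 : Rabs (a * x) <= Rabs a * e)
    by (rewrite Rabs_mult; apply Rmult_le_compat_l; [apply Rabs_pos|assumption]).
  assert (h2 : Rabs (b * y) <= Rabs b * e)
    by (rewrite Rabs_mult; apply Rmult_le_compat_l; [apply Rabs_pos|assumption]).
  assert (h3 := Rle_abs (- (a * x))). assert (h4 := Rle_abs (- (b * y))).
  rewrite Rabs_Ropp in h3, h4. unfold K in Hke. nra.
Qed.

(** The barycentric coordinates, multiplied by the square of [D], are affine in the point and
    positive at [q], hence nonnegative on a disc around [q]. The explicit coefficients are their
    gradients. *)
Lemma strictly_inside_interior (s : list pt) (u v w q : pt) :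
  In u s -> In v s -> In w s -> strictly_inside u v w q -> in_interior_conv s q.
Proof.
  intros Hu Hv Hw (H1 & H2 & H3). set (D := cross u v w) in *.
  assert (HD : D <> 0) by (intros E; rewrite E in H1; lra).
  destruct (affine_nonneg_near _ (D * - (snd w - snd v)) (D * (fst w - fst v)) H1)
    as (e1 & He1 & K1).
  destruct (affine_nonneg_near _ (D * (snd w - snd u)) (D * - (fst w - fst u)) H2)
    as (e2 & He2 & K2).
  destruct (affine_nonneg_near _ (D * - (snd v - snd u)) (D * (fst v - fst u)) H3)
    as (e3 & He3 & K3).
  exists (Rmin e1 (Rmin e2 e3)). split; [repeat apply Rmin_glb_lt; assumption|].
  intros r Hr. set (e := Rmin e1 (Rmin e2 e3)) in *.
  assert (He : 0 < e) by (repeat apply Rmin_glb_lt; assumption).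
  assert (h1 : e <= e1) by apply Rmin_l.
  assert (h2 : e <= e2) by (eapply Rle_trans; [apply Rmin_r|apply Rmin_l]).
  assert (h3 : e <= e3) by (eapply Rle_trans; [apply Rmin_r|apply Rmin_r]).
  specialize (K1 (fst r - fst q) (snd r - snd q) ltac:(nra)).
  specialize (K2 (fst r - fst q) (snd r - snd q) ltac:(nra)).
  specialize (K3 (fst r - fst q) (snd r - snd q) ltac:(nra)).
  assert (HD2 : 0 < D * D) by (destruct (Rtotal_order D 0) as [?|[?|?]]; nra).
  assert (HI := Rinv_0_lt_compat _ HD2).
  (* The sign of [D] is unknown, so division by [D] passes through its square. *)
  assert (Hn : forall x, 0 <= D * x -> 0 <= x / D).
  { intros x Hx. replace (x / D) with (D * x * / (D * D)) by (field; exact HD).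
    apply Rmult_le_pos; lra. }
  apply (in_conv_triangle s u v w r (cross r v w / D) (cross u r w / D) (cross u v r / D)); auto.
  - apply Hn. eapply Rle_trans; [exact K1|]. right. unfold cross. ring.
  - apply Hn. eapply Rle_trans; [exact K2|]. right. unfold cross. ring.
  - apply Hn. eapply Rle_trans; [exact K3|]. right. unfold cross. ring.
  - unfold D, cross in *. field. exact HD.
  - unfold D, cross in *. field. exact HD.
  - unfold D, cross in *. field. exact HD.
Qed.

(** * Cups and caps as chains *)

Lemma increasing_sorted (s : list pt) :
  (forall j, (S j < length s)%nat -> fst (nth j s pd) < fst (nth (S j) s pd)) ->
  StronglySorted ltx s.
Proof.
  intros H. apply Sorted_StronglySorted.
  { intros a b c Hab Hbc. unfold ltx in *. lra. }
  induction s as [|p s IH]; constructor.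
  - apply IH. intros j Hj. apply (H (S j)). simpl. lia.
  - destruct s as [|q s]; constructor. apply (H 0%nat). simpl. lia.
Qed.

Lemma turns_nth (e : R) (s : list pt) :
  (forall j, (S (S j) < length s)%nat ->
     0 < e * cross (nth j s pd) (nth (S j) s pd) (nth (S (S j)) s pd)) -> turns e s.
Proof.
  induction s as [|p s IH]; intros H; [exact I|]. split.
  - destruct s as [|q [|r s]]; auto. apply (H 0%nat). simpl. lia.
  - apply IH. intros j Hj. apply (H (S j)). simpl. lia.
Qed.

(** Links the two notions of convexity: both widths are positive, so orientation and slope
    difference have the same sign. *)
Lemma cross_slope (p q r : pt) : ltx p q -> ltx q r ->
  cross p q r = (fst q - fst p) * (fst r - fst q) * (slope q r - slope p q).
Proof. intros H1 H2. unfold ltx, cross, slope in *. field. lra. Qed.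

Lemma slopes_chain (e : R) (X s : list pt) :
  sub_increasing X s ->
  (forall j, (S (S j) < length s)%nat ->
     0 < e * (slope (nth (S j) s pd) (nth (S (S j)) s pd) - slope (nth j s pd) (nth (S j) s pd))) ->
  chain e X s.
Proof.
  intros [Hi Hx] Ht. split; [exact Hi|]. split; [apply increasing_sorted; exact Hx|].
  apply turns_nth. intros j Hj.
  assert (h1 := Hx j ltac:(lia)). assert (h2 := Hx (S j) Hj). specialize (Ht j Hj).
  rewrite cross_slope by assumption.
  match goal with
  | |- 0 < e * (?a * ?b * ?c) => replace (e * (a * b * c)) with (a * b * (e * c)) by ring
  end.
  apply Rmult_lt_0_compat; [apply Rmult_lt_0_compat; lra|exact Ht].
Qed.

Lemma cup_chain (X s : list pt) (r : nat) : is_cup X r s -> chain 1 X s.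
Proof.
  intros (_ & Hs & Ht). apply slopes_chain; [exact Hs|].
  intros j Hj. specialize (Ht j Hj). lra.
Qed.

Lemma cap_chain (X s : list pt) (r : nat) : is_cap X r s -> chain (Ropp 1) X s.
Proof.
  intros (_ & Hs & Ht). apply slopes_chain; [exact Hs|].
  intros j Hj. specialize (Ht j Hj). lra.
Qed.

Lemma general_position_admissible (X : list pt) : general_position X -> admissible X.
Proof.
  intros [HN HG]. split; [exact HN|].
  assert (HX : forall p q, In p X -> In q X -> p <> q -> ltx p q \/ ltx q p).
  { clear HG. induction X as [|x X IH]; simpl; intros p q Hp Hq Hne; [tauto|].
    simpl in HN. inversion HN as [|? ? Hx HN']; subst.
    assert (Hd : forall y, In y X -> ltx x y \/ ltx y x).
    { intros y Hy. unfold ltx. destruct (Rtotal_order (fst x) (fst y)) as [|[E|]]; auto.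
      exfalso. apply Hx. rewrite E. apply in_map. exact Hy. }
    destruct Hp as [<-|Hp], Hq as [<-|Hq]; auto; [tauto|].
    destruct (Hd p Hp); auto. }
  intros p q r Hp Hq Hr Hpq Hqr Hpr.
  assert (c1 : cross q p r = - cross p q r) by (unfold cross; ring).
  assert (c2 : cross p r q = - cross p q r) by (unfold cross; ring).
  assert (c3 : cross q r p = cross p q r) by (unfold cross; ring).
  assert (c4 : cross r p q = cross p q r) by (unfold cross; ring).
  assert (c5 : cross r q p = - cross p q r) by (unfold cross; ring).
  intros E. rewrite E in c1, c2, c3, c4, c5.
  (* Of the eight patterns two are cyclic and contradictory; the other six are the orders of three
     points, and permuting them changes [cross] at most in sign. *)
  destruct (HX p q Hp Hq Hpq) as [h1|h1], (HX q r Hq Hr Hqr) as [h2|h2],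
    (HX p r Hp Hr Hpr) as [h3|h3]; try (unfold ltx in *; lra).
  - apply (HG p q r); auto.
  - apply (HG p r q); auto. lra.
  - apply (HG r p q); auto.
  - apply (HG q p r); auto. lra.
  - apply (HG q r p); auto.
  - apply (HG r q p); auto. lra.
Qed.

(** Any list enumerating the points inside contains the [N] certified ones. *)
Lemma sparse_avoiding_inside (e : R) (X s : list pt) (l m N k : nat) :
  sparse_avoiding e X l m N -> (k < N)%nat -> chain e X s -> length s = l ->
  ~ at_most_inside X s k.
Proof.
  intros (_ & _ & HQ) Hk Hs Hl (W & _ & HW & HWk).
  destruct (HQ s Hs Hl) as (Q & HN & HL & HI & Hq).
  assert (h : (length Q <= length W)%nat); [|lia].
  apply NoDup_incl_length; [exact HN|]. intros q Hin. apply HW. split; [auto|].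
  destruct (Hq q Hin) as (u & v & w & Hu & Hv & Hw & H).
  exact (strictly_inside_interior s u v w q Hu Hv Hw H).
Qed.

Theorem mainTheorem6 (l m a : nat) (hl : (4 <= l)%nat) (hm : (4 <= m)%nat) :
  ((m <= binom (l + m - 6) (l - 3) + 1)%nat ->
     exists X : list pt, admissible X /\ (fES l m <= length X)%nat /\
       ~ has_good_cup_or_cap X l m (binom (l + m - 6) (l - 3) + 1 - m) a) /\
  ((l <= binom (l + m - 6) (m - 3) + 1)%nat ->
     exists X : list pt, admissible X /\ (fES l m <= length X)%nat /\
       ~ has_good_cup_or_cap X l m a (binom (l + m - 6) (m - 3) + 1 - l)).
Proof.
  (* Writing l = i+4 and m = j+4 removes the truncated subtractions. *)
  assert (Hl : l = (l - 4 + 4)%nat) by lia. assert (Hm : m = (m - 4 + 4)%nat) by lia.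
  revert Hl Hm. generalize (l - 4)%nat as i, (m - 4)%nat as j. intros i j -> ->.
  clear hl hm. unfold fES.
  replace (i + 4 + (j + 4) - 6)%nat with (i + j + 2)%nat by lia.
  replace (i + 4 + (j + 4) - 4)%nat with (i + j + 4)%nat by lia.
  replace (i + 4 - 3)%nat with (i + 1)%nat by lia.
  replace (i + 4 - 2)%nat with (i + 2)%nat by lia.
  replace (j + 4 - 3)%nat with (j + 1)%nat by lia.
  split; intros Hk.
  - destruct (avoiding_set i j) as (X & N & HL & HN & HX).
    exists X. split; [apply general_position_admissible, HX|]. split; [lia|].
    intros [(s & Hs & Hin)|(s & Hs & _)].
    (* The hypothesis gives [N] at least 1, and the stated number of points inside is exactly
       N-1. *)
    + revert Hin. apply (sparse_avoiding_inside 1 X s (i + 4) (j + 3) N);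
        [exact HX|lia|eapply cup_chain; exact Hs|apply Hs].
    + assert (h := proj1 (proj2 HX) s (cap_chain _ _ _ Hs)). rewrite (proj1 Hs) in h. lia.
  (* Exchange the roles of l and m and reflect; the size is unchanged by the symmetry of the
     binomial coefficient. *)
  - destruct (avoiding_set j i) as (X & N & HL & HN & HX).
    apply sparse_avoiding_reflect in HX.
    assert (Hsym : binom (i + j + 4) (i + 2) = binom (j + i + 4) (j + 2)).
    { replace (i + j + 4)%nat with (i + 2 + (j + 2))%nat by lia. rewrite binom_sym.
      f_equal. lia. }
    replace (j + i + 2)%nat with (i + j + 2)%nat in HN by lia.
    exists (map reflect X). split; [apply general_position_admissible, HX|].
    split; [rewrite length_map; lia|].
    intros [(s & Hs & _)|(s & Hs & Hin)].
    + assert (Hc := cup_chain _ _ _ Hs). rewrite <- (Ropp_involutive 1) in Hc.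
      assert (h := proj1 (proj2 HX) s Hc). rewrite (proj1 Hs) in h. lia.
    + revert Hin. apply (sparse_avoiding_inside (Ropp 1) (map reflect X) s (j + 4) (i + 3) N);
        [exact HX|lia|eapply cap_chain; exact Hs|apply Hs].
Qed.
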